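(* Let $\Phi$ be a function on CP problems such that for each CP problem $(\mathcal{R}/\mathcal{S},L)$: if there are TRSs $\mathcal{R}_1,\mathcal{R}_2$ with $\mathcal{R}=\mathcal{R}_1\cup\mathcal{R}_2$ and a complexity pair $(\succ,\succsim)$ such that $\mathcal{R}_2\subseteq\succ$ and $\mathcal{R}_1\cup\mathcal{S}\subseteq\succsim$, then $\Phi(\mathcal{R}/\mathcal{S},L)=\{(\mathcal{R}_1/(\mathcal{R}_2\cup\mathcal{S}),L,f)\}$ for some such $\mathcal{R}_1,\mathcal{R}_2,(\succ,\succsim)$, where $f(n)=\mathrm{cp}(n,\succ,L)$; and otherwise $\Phi(\mathcal{R}/\mathcal{S},L)=\{(\mathcal{R}/\mathcal{S},L,\mathbf{0})\}$. Then $\Phi$ is a sound CP processor.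
   Context: A complexity pair $(\succ,\succsim)$ consists of two finitely branching rewrite relations (relations on terms closed under contexts and substitutions) with $\succsim\cdot\succ\subseteq\succ$ and $\succ\cdot\succsim\subseteq\succ$. $\to_{\mathcal{R}/\mathcal{S}}=\to_{\mathcal{S}}^*\cdot\to_{\mathcal{R}}\cdot\to_{\mathcal{S}}^*$; $\mathrm{dl}(t,\to)=\sup\{m\mid\exists u,\ t\to^mu\}$; $\mathrm{cp}(n,\to,L)=\sup\{\mathrm{dl}(t,\to)\mid t\in L,|t|\le n\}$. A CP problem is a pair $(\mathcal{R}/\mathcal{S},L)$ of a relative TRS and a set of terms $L$. A CP processor maps a CP problem to a finite set of triples $(\mathcal{R}_i/\mathcal{S}_i,L_i,f_i)$, $1\le i\le m$, with $(\mathcal{R}_i/\mathcal{S}_i,L_i)$ CP problems and $f_i:\mathbb{N}\to\mathbb{N}$. It is sound if for every input $(\mathcal{R}/\mathcal{S},L)$, $\mathrm{cp}(n,\to_{\mathcal{R}/\mathcal{S}},L)=O(f_1(n)+\dots+f_m(n)+\sum_i\mathrm{cp}(n,\to_{\mathcal{R}_i/\mathcal{S}_i},L_i))$. $\mathbf{0}$ is the constant zero function.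
   Formalization: The functions f_i of a CP processor may take values in ℕ ∪ {∞} instead of ℕ, since f(n) = cp(n, ≻, L) can be infinite (for example when ≻ is the identity relation, which the definition of complexity pair allows). *)

(* Defs.v *)
From HB Require Import structures.
From Stdlib Require Import Relations.Relation_Operators.
From mathcomp Require Import all_boot all_order all_algebra.
From mathcomp Require Import boolp classical_sets functions cardinality fsbigop.

Set Implicit Arguments.
Unset Strict Implicit.
Unset Printing Implicit Defensive.

Import Order.TTheory GRing.Theory.
Local Open Scope classical_set_scope.
Local Open Scope ring_scope.

(* N u {oo}: [None] is oo.  Derivation lengths and complexities are suprema in
   this type, hence total.  The nmodType structure below makes [_ *+ M] the
   multiplication by M : nat, with oo *+ 0 = 0. *)
Definition enat := option nat.
HB.instance Definition _ := Countable.on enat.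

Definition efin (n : nat) : enat := Some n.

Definition enat_add (x y : enat) : enat :=
  if x is Some m then if y is Some n then Some (m + n)%N else None else None.

Lemma enat_addA : associative enat_add.
Proof. by move=> [m|] [n|] [p|] //=; rewrite addnA. Qed.

Lemma enat_addC : commutative enat_add.
Proof. by move=> [m|] [n|] //=; rewrite addnC. Qed.

Lemma enat_add0 : left_id (efin 0) enat_add.
Proof. by case. Qed.

HB.instance Definition _ :=
  GRing.isNmodule.Build enat enat_addA enat_addC enat_add0.

Definition enat_le (x y : enat) : bool :=
  if y is Some n then if x is Some m then (m <= n)%N else false else true.

Definition enat_lt (x y : enat) : bool := (y != x) && enat_le x y.

Lemma enat_le_anti : antisymmetric enat_le.
Proof. by move=> [m|] [n|] //= /anti_leq ->. Qed.

Lemma enat_le_trans : transitive enat_le.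
Proof. by move=> [m|] [n|] [p|] //=; apply: leq_trans. Qed.

Lemma enat_le_total : total enat_le.
Proof. by move=> [m|] [n|] //=; apply: leq_total. Qed.

Fact enat_display : Order.disp_t.
Proof. exact: Order.Disp tt tt. Qed.

HB.instance Definition _ := Order.isOrder.Build enat_display enat
  (fun _ _ => erefl) (fun _ _ => erefl) (fun _ _ => erefl)
  enat_le_anti enat_le_trans enat_le_total.

(* Every set of extended naturals has a supremum, so the default value in
   [supremum 0 A] is only ever used for A = set0, where it is the right one. *)
Lemma enat_supremums_neq0 (A : set enat) : supremums A !=set0.
Proof.
have [[n An]|Aoo] := pselect (exists n : nat, ubound A (efin n)).
  have ex_n : exists n : nat, `[< ubound A (efin n) >] by exists n; apply/asboolP.
  case: (ex_minnP ex_n) => m /asboolP Am minm; exists (efin m); split=> //.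
  by move=> [p|] Ap //; apply: minm; apply/asboolP.
exists None; split=> [[m|] _ //|[p|] // Ap].
by case: Aoo; exists p.
Qed.

Definition is_bigO (g h : nat -> enat) : Prop :=
  exists M N : nat, forall n, (N <= n)%N -> (g n <= h n *+ M)%O.

Record signature := Signature { symbol :> Type; arity : symbol -> nat }.
Arguments arity {s}.

Section Rewriting.
Variables (F : signature) (V : Type).

Inductive term : Type :=
| Var of V
| App (f : F) of {ffun 'I_(arity f) -> term}.

Definition is_var (t : term) : Prop := if t is Var _ then True else False.

Fixpoint occurs (x : V) (t : term) : Prop :=
  match t with
  | Var y => x = y
  | App f ts => exists i, occurs x (ts i)
  end.

Fixpoint tsize (t : term) : nat :=
  match t with
  | Var _ => 1
  | App f ts => (\sum_(i < arity f) tsize (ts i)).+1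
  end.

Fixpoint subst (sigma : V -> term) (t : term) : term :=
  match t with
  | Var x => sigma x
  | App f ts => App [ffun i => subst sigma (ts i)]
  end.

(* In [CApp f ts i C] the hole lies in the i-th argument, and [ts i] is
   irrelevant. *)
Inductive context : Type :=
| Hole
| CApp (f : F) (ts : {ffun 'I_(arity f) -> term}) (i : 'I_(arity f))
    (C : context).

Fixpoint fill (C : context) (t : term) : term :=
  match C with
  | Hole => t
  | CApp f ts i C' => App [ffun j => if j == i then fill C' t else ts j]
  end.

Definition trel := term -> term -> Prop.

Definition rewrite_relation (r : trel) : Prop :=
  (forall C s t, r s t -> r (fill C s) (fill C t)) /\
  (forall sigma s t, r s t -> r (subst sigma s) (subst sigma t)).

Definition finitely_branching (r : trel) : Prop :=
  forall s, finite_set [set t | r s t].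

Definition rcomp (r1 r2 : trel) : trel :=
  fun s t => exists2 u, r1 s u & r2 u t.

Definition rsub (r1 r2 : trel) : Prop := forall s t, r1 s t -> r2 s t.

Definition complexity_pair (gt ge : trel) : Prop :=
  [/\ rewrite_relation gt /\ finitely_branching gt,
      rewrite_relation ge /\ finitely_branching ge,
      rsub (rcomp ge gt) gt
    & rsub (rcomp gt ge) gt].

Record rule := Rule {
  lhs : term;
  rhs : term;
  lhs_nonvar : ~ is_var lhs;
  rhs_vars : forall x, occurs x rhs -> occurs x lhs }.

Definition trs := set rule.

Definition oriented (R : trs) (r : trel) : Prop :=
  forall rl, R rl -> r (lhs rl) (rhs rl).

Definition step (R : trs) : trel := fun s t =>
  exists2 rl, R rl & exists C sigma,
    s = fill C (subst sigma (lhs rl)) /\ t = fill C (subst sigma (rhs rl)).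

Definition rel_step (R S : trs) : trel :=
  rcomp (clos_refl_trans _ (step S))
    (rcomp (step R) (clos_refl_trans _ (step S))).

Fixpoint nsteps (r : trel) (m : nat) : trel :=
  if m is m'.+1 then rcomp r (nsteps r m') else eq.

Definition dl (t : term) (r : trel) : enat :=
  supremum (0 : enat) [set efin m | m in [set m | exists u, nsteps r m t u]].

Definition cp (n : nat) (r : trel) (L : set term) : enat :=
  supremum (0 : enat) [set dl t r | t in [set t | L t /\ (tsize t <= n)%N]].

Record cp_problem := CPProblem {
  strict_part : trs;
  weak_part : trs;
  start_terms : set term }.

HB.instance Definition _ := gen_eqMixin cp_problem.
HB.instance Definition _ := gen_choiceMixin cp_problem.

Definition cp_of (P : cp_problem) (n : nat) : enat :=
  cp n (rel_step (strict_part P) (weak_part P)) (start_terms P).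

(* The bound f_i takes values in N u {oo}, as does cp. *)
Definition cp_triple : Type := cp_problem * (nat -> enat).

Definition cp_processor (Phi : cp_problem -> set cp_triple) : Prop :=
  forall P, finite_set (Phi P).

Definition sound (Phi : cp_problem -> set cp_triple) : Prop :=
  forall P, is_bigO (cp_of P)
    (fun n => \sum_(p \in Phi P) p.2 n + \sum_(p \in Phi P) cp_of p.1 n).

Definition cp_applicable (R S R1 R2 : trs) (gt ge : trel) : Prop :=
  [/\ R = R1 `|` R2, complexity_pair gt ge, oriented R2 gt
    & oriented (R1 `|` S) ge].

End Rewriting.

Arguments Hole {F V}.

(* Main.v *)
(* In a derivation of R1 u R2 relative to S, mark every R-step as an R1-step
   or an R2-step.  The R1-steps form a derivation of R1 relative to R2 u S.  The
   R2-steps lie in > and all others in >=, which > absorbs from the left, so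
   there is a >-derivation with as many steps as there are R2-steps.  Hence the
   length is at most dl(t, >) + dl(t, R1/(R2 u S)); take suprema. *)
Require Import Defs.
From Stdlib Require Import Relations.Relation_Operators.
From mathcomp Require Import all_boot all_order all_algebra.
From mathcomp Require Import boolp classical_sets functions cardinality fsbigop.

Set Implicit Arguments.
Unset Strict Implicit.
Unset Printing Implicit Defensive.

Import Order.TTheory GRing.Theory.

Local Open Scope classical_set_scope.
Local Open Scope ring_scope.

Lemma supremum_enat_le (A : set enat) (b : enat) :
  (supremum (0 : enat) A <= b)%O <-> ubound A b.
Proof.
(* For [set0] the default value 0 is the least element of [enat], so both sides hold. *)
rewrite /supremum; case: eqP => [->|A0]; first by split=> _; [move=> ? []|case: b].
case: xgetP => [y _ [Ay ymin]|noy].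
  split=> [yb x Ax|Ab]; last exact: ymin.
  exact: le_trans (Ay x Ax) yb.
(* The default branch of [xget] cannot occur, as every set of extended naturals has a supremum. *)
by have [y sy] := enat_supremums_neq0 A; have := noy y.
Qed.

Lemma supremum_enat_ub (A : set enat) : ubound A (supremum (0 : enat) A).
Proof. exact/supremum_enat_le. Qed.

Lemma enat_leD (a b c d : enat) : (a <= b -> c <= d -> a + c <= b + d)%O.
Proof.
case: a b c d => [a|] [b|] [c|] [d|] // ab cd.
exact: (leq_add ab cd : (efin (a + c) <= efin (b + d))%O).
Qed.

Section Rewriting.
Variables (F : signature) (V : Type).
Implicit Types (r q gt ge : trel F V) (R S : trs F V).

Definition derives r (m : nat) (t : term F V) : Prop := exists u, nsteps r m t u.

Lemma derives_succ r m s t : r s t -> derives r m t -> derives r m.+1 s.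
Proof. by move=> rst [u tu]; exists u, t. Qed.

(** The [q]-steps are swallowed one by one by the first [r]-step; if [m] is 0, the empty derivation
    from [s] serves. *)
Lemma derives_absorb r q m s t : rsub (rcomp q r) r ->
  clos_refl_trans _ q s t -> derives r m t -> derives r m s.
Proof.
move=> qr; elim=> {s t} [s t qst||s u t _ IH1 _ IH2 /IH2/IH1] //.
case: m => [_|m [v [u rtu uv]]]; first by exists s.
by exists v, u => //; apply: qr; exists t.
Qed.

(** A relative step starts with arbitrarily many weak steps, so one more fits in. Thus
    [derives_absorb] serves relative rewriting just as it serves a complexity pair. *)
Lemma rel_step_absorb R S : rsub (rcomp (step S) (rel_step R S)) (rel_step R S).
Proof.
move=> s t [u su [v uv vt]]; exists v => //.
by apply: rt_trans uv; apply: rt_step.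
Qed.

Lemma clos_refl_trans_sub r q s t : rsub r q ->
  clos_refl_trans _ r s t -> clos_refl_trans _ q s t.
Proof.
move=> rq; elim=> {s t} [s t /rq||s u t _ su _ ut];
  [exact: rt_step|exact: rt_refl|exact: rt_trans su ut].
Qed.

Lemma step_sub R R' : R `<=` R' -> rsub (step R) (step R').
Proof. by move=> RR' s t [rl /RR' Rrl Cs]; exists rl. Qed.

Lemma oriented_step R r : rewrite_relation r -> oriented R r -> rsub (step R) r.
Proof.
by move=> [rC rS] Rr s t [rl /Rr rl_r [C [sg [-> ->]]]]; apply/rC/rS.
Qed.

(** Induction on [m] prepends one relative step at a time, so both derivations grow at the front,
    where absorption from the left applies. *)
Lemma derives_rel_stepU R1 R2 S gt ge m t :
  cp_applicable (R1 `|` R2) S R1 R2 gt ge ->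
  derives (rel_step (R1 `|` R2) S) m t ->
  exists a b, [/\ m = (a + b)%N, derives gt a t
                & derives (rel_step R1 (R2 `|` S)) b t].
Proof.
move=> [_ [[gtR _] [geR _] ge_gt _] R2gt R1Sge].
have R2_gt := oriented_step gtR R2gt; have R1S_ge := oriented_step geR R1Sge.
have R1_ge : rsub (step R1) ge.
  by move=> x y xy; apply: R1S_ge; apply: step_sub xy => ? ?; left.
have S_ge : rsub (step S) ge.
  by move=> x y xy; apply: R1S_ge; apply: step_sub xy => ? ?; right.
have S_R2S : rsub (step S) (step (R2 `|` S)) by apply: step_sub => ? ?; right.
have R2_R2S : rsub (step R2) (step (R2 `|` S)) by apply: step_sub => ? ?; left.
(* An [S]-step lies both in [ge] and in the weak part [R2 u S], so preceding [S]-steps change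
   neither [a] nor [b]. *)
have absS s u a b : clos_refl_trans _ (step S) s u -> derives gt a u ->
    derives (rel_step R1 (R2 `|` S)) b u ->
    derives gt a s /\ derives (rel_step R1 (R2 `|` S)) b s.
  move=> su ua ub; split.
    exact: derives_absorb ge_gt (clos_refl_trans_sub S_ge su) ua.
  exact: derives_absorb (@rel_step_absorb _ _) (clos_refl_trans_sub S_R2S su) ub.
elim: m t => [|m IH] t [u]; first by exists 0%N, 0%N; split=> //; exists t.
move=> [w [x tx [y xy yw]] wu].
have [a [b [-> wa wb]]] := IH w (ex_intro _ u wu).
have [ya yb] := absS _ _ _ _ yw wa wb.
have [rl [R1rl|R2rl] Cxy] := xy.
  (* An [R1]-step is absorbed by [gt] and adds one to [b], as a relative step with empty weak
     parts. *)
  have {}xy : step R1 x y by exists rl.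
  have xa : derives gt a x := derives_absorb ge_gt (rt_step _ _ _ _ (R1_ge _ _ xy)) ya.
  have xb : derives (rel_step R1 (R2 `|` S)) b.+1 x.
    apply: derives_succ yb; exists x; first exact: rt_refl.
    by exists y => //; apply: rt_refl.
  have [ta tb] := absS _ _ _ _ tx xa xb.
  by exists a, b.+1; rewrite addnS.
(* Dually, an [R2]-step is a [gt]-step, which adds one to [a], and is absorbed as a weak step on the
   other side. *)
have {}xy : step R2 x y by exists rl.
have xa : derives gt a.+1 x := derives_succ (R2_gt _ _ xy) ya.
have xb := derives_absorb (@rel_step_absorb _ _) (rt_step _ _ _ _ (R2_R2S _ _ xy)) yb.
have [ta tb] := absS _ _ _ _ tx xa xb.
by exists a.+1, b; rewrite addSn.
Qed.

Lemma derives_le_cp r m t n (L : set (term F V)) :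
  L t -> (Defs.tsize t <= n)%N -> derives r m t -> (efin m <= cp n r L)%O.
Proof.
move=> Lt tn rmt; apply: (@le_trans _ _ (dl t r)).
  by apply: supremum_enat_ub; exists m.
by apply: supremum_enat_ub; exists t.
Qed.

Lemma cp_applicable_le R S R1 R2 gt ge n (L : set (term F V)) :
  cp_applicable R S R1 R2 gt ge ->
  (cp n (rel_step R S) L <= cp n gt L + cp n (rel_step R1 (R2 `|` S)) L)%O.
Proof.
move=> app; have [RE _ _ _] := app; rewrite {}RE in app *.
apply/supremum_enat_le => _ [t [Lt tn] <-].
apply/supremum_enat_le => _ [m mt <-].
have [a [b [-> ta tb]]] := derives_rel_stepU app mt.
exact: (enat_leD (derives_le_cp Lt tn ta) (derives_le_cp Lt tn tb)).
Qed.

End Rewriting.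

Theorem theorem7p3 (F : signature) (V : Type)
    (Phi : cp_problem F V -> set (cp_triple F V)) :
  (forall (R S : trs F V) (L : set (term F V)),
     ((exists (R1 R2 : trs F V) (gt ge : trel F V),
         cp_applicable R S R1 R2 gt ge) ->
      exists (R1 R2 : trs F V) (gt ge : trel F V),
        cp_applicable R S R1 R2 gt ge /\
        Phi (CPProblem R S L) =
          [set (CPProblem R1 (R2 `|` S) L, fun n => cp n gt L)]) /\
     (~ (exists (R1 R2 : trs F V) (gt ge : trel F V),
           cp_applicable R S R1 R2 gt ge) ->
      Phi (CPProblem R S L) = [set (CPProblem R S L, fun=> 0)])) ->
  cp_processor Phi /\ sound Phi.
Proof.
(* In both cases the output is a single triple, and the bound holds at every [n]; in the second case
   it is an equality. *)
move=> PhiE; have PhiP (P : cp_problem F V) : exists p, Phi P = [set p] /\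
    forall n, (cp_of P n <= p.2 n + cp_of p.1 n)%O.
  case: P => R S L; have [PhiA PhiN] := PhiE R S L.
  have [/PhiA [R1 [R2 [gt [ge [app PhiRS]]]]]|/PhiN PhiRS] := pselect
      (exists (R1 R2 : trs F V) (gt ge : trel F V), cp_applicable R S R1 R2 gt ge).
    by rewrite PhiRS; eexists; split=> // n; apply: cp_applicable_le app.
  by rewrite PhiRS; eexists; split=> // n; rewrite add0r.
split=> P; have [p [-> Pp]] := PhiP P; first exact: finite_set1.
(* The pointwise bound gives factor 1 and threshold 0. *)
by exists 1%N, 0%N => n _; rewrite !fsbig_set1 mulr1n.
Qed.
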